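(* Let $q\in\mathbb C$ with $|q|=1$, and let $X,Z$ be any unitary operators on a complex Hilbert space $\mathcal H_a$ satisfying $ZX=q^2XZ$. Let $\sigma\in\{+,-\}$, and let $W_\sigma$, $h$, $S_\sigma$ be the operators built from $q,X,Z$ in the context. Then: (1) $W_\sigma^\dagger W_\sigma=W_\sigma W_\sigma^\dagger=I_{\mathbb C^2\otimes\mathcal H_a}$. (2) $S_\sigma$ is Hermitian and, on $\mathbb C^2_A\otimes\mathbb C^2_B\otimes\mathbb C^2_C\otimes\mathcal H_a$, $$W_{\sigma,Ba}^{\dagger}\bigl(h_{BC}+S_{\sigma,ABa}\bigr)W_{\sigma,Ba}=h_{AB}+S_{\sigma,BCa}.$$ (3) $S_\sigma$ has vanishing physical diagonal (the $\mathcal H_a$-valued coefficient of $E_{rr}$ is $0$ for $r=0,1,2,3$) and vanishing partial trace over the two physical spins; if $\mathcal H_a$ is finite-dimensional, then $\operatorname{Tr}S_\sigma=0$.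
   Context: Write $\omega=q^2$ and $Y_{m,n}=X^mZ^n$ for $m,n\in\mathbb Z$. A physical site is $\mathbb C^2$ with basis $|0\rangle,|1\rangle$; $\sigma^+=|0\rangle\langle1|$, $\sigma^-=|1\rangle\langle0|$, $\sigma^z=\operatorname{diag}(1,-1)$. Gates on $\mathbb C^2\otimes\mathcal H_a$, written as $2\times2$ matrices with entries operators on $\mathcal H_a$ (the $(r,s)$ entry multiplies $|r\rangle\langle s|$): $W_\sigma=L_\sigma/\sqrt2$, $$L_+=\begin{pmatrix}I&\omega X^{-1}\\ -qXZ&qZ\end{pmatrix},\qquad L_-=\begin{pmatrix}qZ&-qX^{-1}Z\\ X&\omega I\end{pmatrix}.$$ Bond density on an ordered pair of spins $(i,j)$: $$h_{ij}=q\,\sigma_i^+\sigma_j^-+q^{-1}\sigma_i^-\sigma_j^++\tfrac{q+q^{-1}}4\sigma_i^z\sigma_j^z.$$ In the ordered two-spin basis $|0\rangle=|00\rangle$, $|1\rangle=|01\rangle$, $|2\rangle=|10\rangle$, $|3\rangle=|11\rangle$ put $E_{rc}=|r\rangle\langle c|$. The seams are the operators on $\mathbb C^2\otimes\mathbb C^2\otimes\mathcal H_a$ $$\begin{aligned}S_+=\tfrac12\bigl[&-E_{01}Y_{-1,-1}+q^3E_{02}Y_{-1,0}-q^4E_{03}Y_{-2,-1}-q^2E_{10}Y_{1,1}+q^2E_{12}Y_{0,1}-qE_{13}Y_{-1,0}\\ &+q^{-3}E_{20}Y_{1,0}+q^{-2}E_{21}Y_{0,-1}+q^2E_{23}Y_{-1,-1}-E_{30}Y_{2,1}-q^{-1}E_{31}Y_{1,0}+E_{32}Y_{1,1}\bigr],\\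 S_-=\tfrac12\bigl[&E_{01}Y_{-1,1}-qE_{02}Y_{-1,0}-E_{03}Y_{-2,1}+q^{-2}E_{10}Y_{1,-1}+q^2E_{12}Y_{0,-1}+q^3E_{13}Y_{-1,0}\\ &-q^{-1}E_{20}Y_{1,0}+q^{-2}E_{21}Y_{0,1}-q^{-2}E_{23}Y_{-1,1}-q^{-4}E_{30}Y_{2,-1}+q^{-3}E_{31}Y_{1,0}-E_{32}Y_{1,-1}\bigr],\end{aligned}$$ where $E_{rc}Y_{m,n}$ means $E_{rc}\otimes Y_{m,n}$. Subscripts indicate the tensor factors acted on (identity on the others): $W_{\sigma,Ba}$ acts on site $B$ and $\mathcal H_a$; $S_{\sigma,ABa}$ acts on the ordered pair $(A,B)$ and $\mathcal H_a$; $S_{\sigma,BCa}$ is the same tensor on $(B,C)$ and $\mathcal H_a$. *)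

(* Defs.v *)
From HB Require Import structures.
From mathcomp Require Import all_boot all_order all_algebra sesquilinear complex.
From mathcomp Require Import all_classical all_reals all_analysis.

Set Implicit Arguments.
Unset Strict Implicit.
Unset Printing Implicit Defensive.

Import Order.TTheory GRing.Theory Num.Theory.
Import numFieldNormedType.Exports.

Local Open Scope classical_set_scope.
Local Open Scope ring_scope.

(* The inner product is MathComp's positive definite Hermitian form, linear in
   its first and conjugate-linear in its second argument. *)
HB.mixin Record isInner (C : numClosedFieldType) V of GRing.Lmodule C V :=
  { inner_form : {dot V for (@Num.conj C)} }.

#[short(type="innerType")]
HB.structure Definition Inner (C : numClosedFieldType) :=
  { V of isInner C V & GRing.Lmodule C V }.

Definition inner {C : numClosedFieldType} {V : innerType C} (u v : V) : C :=
  (inner_form : {dot V for (@Num.conj C)}) u v.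

HB.mixin Record isHilbert (R : realType) H
    of Inner R[i] H & CompleteNormedModule R[i] H :=
  { inner_norm : forall u : H, inner u u = `|u| ^+ 2 }.

#[short(type="hilbertType")]
HB.structure Definition Hilbert (R : realType) :=
  { H of isHilbert R H & Inner R[i] H & CompleteNormedModule R[i] H }.

(* For a finite basis type I of spin configurations, the Hilbert space
   C^I (x) V is modelled by {ffun I -> V}; its inner product is the sum over I
   of the inner products of the components. *)
Section TensorInner.
Variables (C : numClosedFieldType) (I : finType) (V : innerType C).

Definition ffun_inner (f g : {ffun I -> V}) : C := \sum_i inner (f i) (g i).

Fact ffun_inner_bilinear :
  bilinear_for *%R ((@Num.conj C) \; *%R) ffun_inner.
Proof.
split=> [g a f1 f2|f a g1 g2].
  rewrite /= mulr_sumr -big_split; apply: eq_bigr => i _ /=.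
  by rewrite !ffunE /inner linearPl.
rewrite /= mulr_sumr -big_split; apply: eq_bigr => i _ /=.
by rewrite !ffunE /inner linearPr.
Qed.

HB.instance Definition _ :=
  bilinear_isBilinear.Build C {ffun I -> V} {ffun I -> V} C
    *%R ((@Num.conj C) \; *%R) ffun_inner ffun_inner_bilinear.

Fact ffun_inner_hermitian (f g : {ffun I -> V}) :
  ffun_inner f g = (-1) ^+ false * (ffun_inner g f)^*.
Proof.
rewrite expr0 mul1r rmorph_sum; apply: eq_bigr => i _.
by rewrite /inner [LHS]hermitian_subproof expr0 mul1r.
Qed.

HB.instance Definition _ :=
  isHermitianSesquilinear.Build C {ffun I -> V} false (@Num.conj C)
    ffun_inner ffun_inner_hermitian.

Fact ffun_inner_gt0 (f : {ffun I -> V}) : f != 0 -> 0 < ffun_inner f f.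
Proof.
move=> f0; have [i fi0] : exists i, f i != 0.
  apply: contrapT => /forallNP h; move/eqP: f0; apply.
  by apply/ffunP => i; rewrite ffunE; apply/eqP/negPn/negP/h.
rewrite /ffun_inner (bigD1 i) //= ltr_pwDl //; first exact: neq0_dnorm_gt0.
by apply: sumr_ge0 => j _; apply: dnorm_ge0.
Qed.

HB.instance Definition _ :=
  isDotProduct.Build C {ffun I -> V} ffun_inner ffun_inner_gt0.

HB.instance Definition _ := isInner.Build C {ffun I -> V}
  (ffun_inner : {dot {ffun I -> V} for (@Num.conj C)}).
End TensorInner.

Section Adjoint.
Variables (C : numClosedFieldType) (V : innerType C).
Implicit Types T : V -> V.

Definition is_adjoint T T' := forall u v, inner (T u) v = inner u (T' v).

(* The value 0 is only taken when T has no everywhere defined adjoint. *)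
Definition adj T : V -> V := xget 0 [set T' | is_adjoint T T'].

Lemma adj_eq T T' : is_adjoint T T' -> adj T = T'.
Proof.
move=> TT'; have aP : is_adjoint T (adj T).
  by apply: (@xgetPex _ 0 [set T' | is_adjoint T T']); exists T'.
apply/funext => v; apply/eqP; rewrite -subr_eq0 -(dnorm_eq0 inner_form).
rewrite linearBr subr_eq0; apply/eqP.
by rewrite -[LHS]/(inner _ _) -[RHS]/(inner _ _) -aP -TT'.
Qed.

(* For a linear U these equations force U to be a surjective isometry, hence
   bounded. *)
Definition unitary_op (U : V -> V) :=
  adj U \o U = idfun /\ U \o adj U = idfun.

Definition hermitian_op T := adj T = T.
End Adjoint.

Section Powers.
Variable V : zmodType.
Implicit Types T : V -> V.

Definition op_inv T : V -> V := xget 0 [set T' | cancel T T' /\ cancel T' T].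

Lemma op_invE T T' : cancel T T' -> cancel T' T -> op_inv T = T'.
Proof.
move=> K1 K2; have [K3 K4] : cancel T (op_inv T) /\ cancel (op_inv T) T.
  by apply: (@xgetPex _ 0 [set T' | cancel T T' /\ cancel T' T]); exists T'.
by apply/funext => v; rewrite -{1}[v]K2 K3.
Qed.

Definition op_exp T (m : int) : V -> V :=
  match m with Posz n => iter n T | Negz n => iter n.+1 (op_inv T) end.
End Powers.

Section Blocks.
Variables (C : numClosedFieldType) (I : finType) (V : lmodType C).

(* The operator on C^I (x) V with operator-valued matrix entries L i j. *)
Definition op_block (L : I -> I -> V -> V) (f : {ffun I -> V}) : {ffun I -> V} :=
  [ffun i => \sum_j L i j (f j)].

Definition ket_tensor (j : I) (v : V) : {ffun I -> V} :=
  [ffun i => if i == j then v else 0].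

(* The coefficient of |i><j| in T. *)
Definition coefficient (T : {ffun I -> V} -> {ffun I -> V}) (i j : I) : V -> V :=
  fun v => T (ket_tensor j v) i.

(* The partial trace over C^I, an operator on V. *)
Definition partial_trace (T : {ffun I -> V} -> {ffun I -> V}) : V -> V :=
  \sum_i coefficient T i i.
End Blocks.

Section Trace.
Variables (C : numClosedFieldType) (V : lmodType C).

Definition is_basis n (b : 'I_n -> V) :=
  forall v, exists! c : 'rV[C]_n, v = \sum_i c 0 i *: b i.

Definition finite_dim := exists n (b : 'I_n -> V), is_basis b.

Definition represents n (b : 'I_n -> V) (T : V -> V) (A : 'M[C]_n) :=
  forall j, T (b j) = \sum_i A i j *: b i.

(* V is finite-dimensional and, in every basis, T has a matrix of trace t. *)
Definition has_trace (T : V -> V) (t : C) :=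
  finite_dim /\
  forall n (b : 'I_n -> V), is_basis b -> exists2 A, represents b T A & \tr A = t.
End Trace.

Notation spin := 'I_2.

Section Gates.
Variables (C : numClosedFieldType) (V : lmodType C).

Definition mx2 (T : Type) (a b c d : T) (r s : spin) : T :=
  if r == 0 then if s == 0 then a else b else if s == 0 then c else d.

Definition sigma_p : 'M[C]_2 := delta_mx 0 1.
Definition sigma_m : 'M[C]_2 := delta_mx 1 0.
Definition sigma_z : 'M[C]_2 := \matrix_(r, s) mx2 1 0 0 (-1) r s.

(* P (x) Q (x) id on C^2 (x) C^2 (x) V. *)
Definition spin_op2 (P Q : 'M[C]_2) :
    {ffun spin * spin -> V} -> {ffun spin * spin -> V} :=
  op_block (fun p p' => ( *:%R (P p.1 p'.1 * Q p.2 p'.2))).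

(* The two-spin basis vector |r>, with 0, 1, 2, 3 standing for 00, 01, 10, 11. *)
Definition ket (r : 'I_4) : spin * spin := (inord (r %/ 2), inord (r %% 2)).

(* E_rc (x) Y on C^2 (x) C^2 (x) V. *)
Definition E_unit (r c : 'I_4) (Y : V -> V) :
    {ffun spin * spin -> V} -> {ffun spin * spin -> V} :=
  op_block (fun p p' => if (p == ket r) && (p' == ket c) then Y else 0).

(* Operators on C^2_A (x) C^2_B (x) C^2_C (x) V, a configuration of the three
   spins being ((a, b), c). *)
Definition on_B (T : {ffun spin -> V} -> {ffun spin -> V})
    (f : {ffun spin * spin * spin -> V}) : {ffun spin * spin * spin -> V} :=
  [ffun p => let: (a, b, c) := p in T [ffun b' => f (a, b', c)] b].

Definition on_AB (T : {ffun spin * spin -> V} -> {ffun spin * spin -> V})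
    (f : {ffun spin * spin * spin -> V}) : {ffun spin * spin * spin -> V} :=
  [ffun p => let: (a, b, c) := p in T [ffun ab => f (ab.1, ab.2, c)] (a, b)].

Definition on_BC (T : {ffun spin * spin -> V} -> {ffun spin * spin -> V})
    (f : {ffun spin * spin * spin -> V}) : {ffun spin * spin * spin -> V} :=
  [ffun p => let: (a, b, c) := p in T [ffun bc => f (a, bc.1, bc.2)] (b, c)].

Variables (q : C).

Definition bond : {ffun spin * spin -> V} -> {ffun spin * spin -> V} :=
  q *: spin_op2 sigma_p sigma_m + q^-1 *: spin_op2 sigma_m sigma_p
  + ((q + q^-1) / 4) *: spin_op2 sigma_z sigma_z.

Variables (X Z : V -> V).

Variant pm := plus | minus.

Definition Y (m n : int) : V -> V := op_exp X m \o op_exp Z n.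

Let omega := q ^+ 2.

Definition gate_L (sigma : pm) : spin -> spin -> V -> V :=
  match sigma with
  | plus => mx2 idfun                (omega *: op_exp X (-1))
                (- q *: (X \o Z))    (q *: Z)
  | minus => mx2 (q *: Z)            (- q *: (op_exp X (-1) \o Z))
                 X                   (omega *: idfun)
  end.

Definition gate_W (sigma : pm) : {ffun spin -> V} -> {ffun spin -> V} :=
  (sqrtC 2)^-1 *: op_block (gate_L sigma).

Definition seam (sigma : pm) : {ffun spin * spin -> V} -> {ffun spin * spin -> V} :=
  match sigma with
  | plus => 2^-1 *:
     (- E_unit 0 1 (Y (-1) (-1)) + q ^+ 3 *: E_unit 0 2 (Y (-1) 0)
      - q ^+ 4 *: E_unit 0 3 (Y (-2) (-1)) - q ^+ 2 *: E_unit 1 0 (Y 1 1)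
      + q ^+ 2 *: E_unit 1 2 (Y 0 1) - q *: E_unit 1 3 (Y (-1) 0)
      + q ^- 3 *: E_unit 2 0 (Y 1 0) + q ^- 2 *: E_unit 2 1 (Y 0 (-1))
      + q ^+ 2 *: E_unit 2 3 (Y (-1) (-1)) - E_unit 3 0 (Y 2 1)
      - q ^- 1 *: E_unit 3 1 (Y 1 0) + E_unit 3 2 (Y 1 1))
  | minus => 2^-1 *:
     (E_unit 0 1 (Y (-1) 1) - q *: E_unit 0 2 (Y (-1) 0)
      - E_unit 0 3 (Y (-2) 1) + q ^- 2 *: E_unit 1 0 (Y 1 (-1))
      + q ^+ 2 *: E_unit 1 2 (Y 0 (-1)) + q ^+ 3 *: E_unit 1 3 (Y (-1) 0)
      - q ^- 1 *: E_unit 2 0 (Y 1 0) + q ^- 2 *: E_unit 2 1 (Y 0 1)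
      - q ^- 2 *: E_unit 2 3 (Y (-1) 1) - q ^- 4 *: E_unit 3 0 (Y 2 (-1))
      + q ^- 3 *: E_unit 3 1 (Y 1 0) - E_unit 3 2 (Y 1 (-1)))
  end.
End Gates.

Arguments bond {C} V q _.

(* Main.v *)
Require Import Defs.
From mathcomp Require Import all_boot all_order all_algebra sesquilinear complex.
From mathcomp Require Import ring zify.
From mathcomp Require Import all_classical all_reals all_analysis.

Set Implicit Arguments.
Unset Strict Implicit.
Unset Printing Implicit Defensive.

Import Order.TTheory GRing.Theory Num.Theory.
Import numFieldNormedType.Exports.

Local Open Scope ring_scope.

(** Each operator of the theorem is a scalar times a matrix whose entries are
    finite sums of terms c q^k X^m Z^n with integers c, k, m, n. The relation
    Z^n X^m = q^(2mn) X^m Z^n, together with |q| = 1 and unitarity, makes this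
    set of matrices closed under products and adjoints by explicit integer
    formulas. Unitarity of W, hermiticity of S and the transport identity thus
    become identities between integer tables, valid over the formal algebra and
    checked by computation. Finally, S has zero diagonal blocks, so in any basis
    of product vectors its matrix has zero diagonal. *)

(** * Formal Laurent polynomials in [q], [X], [Z] and matrices over them *)

(* [(c, (k, m, n))] encodes c q^k X^m Z^n. *)
Definition term : Type := int * (int * int * int).
Definition qpoly := seq term.

(** Reordering [Z^n X^m'] as [X^m' Z^n] costs the factor [q^(2 n m')], which is the last summand of
    the [q]-exponent. *)
Definition term_mul (t u : term) : term :=
  let: (c, (k, m, n)) := t in let: (d, (l, m', n')) := u in
  (c * d, (k + l + 2 * (n * m'), m + m', n + n')).

(** Conjugation fixes the integer [c] and inverts [q]; putting the reversed product [Z^-n X^-m] back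
    in normal order contributes [q^(2 m n)]. *)
Definition term_adj (t : term) : term :=
  let: (c, (k, m, n)) := t in (c, (2 * (m * n) - k, - m, - n)).

Definition term_opp (t : term) : term := (- t.1, t.2).

Definition qmul (p r : qpoly) : qpoly := [seq term_mul t u | t <- p, u <- r].

(** Collects like monomials by their exponent triple. A vanishing coefficient stays in the list, so
    [qzero] tests coefficients rather than emptiness. *)
Fixpoint qinsert (t : term) (p : qpoly) : qpoly :=
  if p is u :: p' then
    if t.2 == u.2 then (t.1 + u.1, t.2) :: p' else u :: qinsert t p'
  else [:: t].

Definition qzero (p : qpoly) := all (fun t => t.1 == 0) (foldr qinsert [::] p).

Definition qeq (p r : qpoly) := qzero (p ++ map term_opp r).

Section FormalMatrices.
Variables (I : eqType) (e : seq I).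
Implicit Types F G : I -> I -> qpoly.
Definition fadd F G i j := F i j ++ G i j.
Definition fmul F G i j := flatten [seq qmul (F i k) (G k j) | k <- e].
Definition fadj F i j := map term_adj (F j i).
Definition fscalar (c : int) (i j : I) : qpoly :=
  if i == j then [:: (c, (0, 0, 0))] else [::].
Definition feq F G := all (fun i => all (fun j => qeq (F i j) (G i j)) e) e.
End FormalMatrices.

(** * Integer tables for the gates, the bond density and the seams *)

(* Explicit lists, since the library enumerations of finite types do not
   compute. *)
Definition spins : seq spin := [:: ord0; ord_max].

Definition spins2 : seq (spin * spin) := [seq (a, b) | a <- spins, b <- spins].

Definition spins3 : seq (spin * spin * spin) :=
  [seq (p, c) | p <- spins2, c <- spins].

Definition fB (F : spin -> spin -> qpoly) (p p' : spin * spin * spin) :=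
  if (p.1.1 == p'.1.1) && (p.2 == p'.2) then F p.1.2 p'.1.2 else [::].

Definition fAB (F : spin * spin -> spin * spin -> qpoly)
    (p p' : spin * spin * spin) :=
  if p.2 == p'.2 then F p.1 p'.1 else [::].

Definition fBC (F : spin * spin -> spin * spin -> qpoly)
    (p p' : spin * spin * spin) :=
  if p.1.1 == p'.1.1 then F (p.1.2, p.2) (p'.1.2, p'.2) else [::].

(** Lookup compares the index [2 * a + b] of a configuration as a natural number instead of going
    through [ket], so that it computes; [ket_eq] shows that both tests agree. *)
Definition flist (l : seq ('I_4 * 'I_4 * term)) (p p' : spin * spin) : qpoly :=
  [seq e.2 | e : 'I_4 * 'I_4 * term <- l
    & (e.1.1 == 2 * p.1 + p.2 :> nat)%N && (e.1.2 == 2 * p'.1 + p'.2 :> nat)%N].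

(* [fgate] encodes sqrt 2 times W, while [fbond] and [fseam] encode 4 times h
   and S. *)
Definition fgate (sigma : pm) : spin -> spin -> qpoly :=
  match sigma with
  | plus => mx2 [:: (1, (0, 0, 0))] [:: (1, (2, -1, 0))]
                [:: (-1, (1, 1, 1))] [:: (1, (1, 0, 1))]
  | minus => mx2 [:: (1, (1, 0, 1))] [:: (-1, (1, -1, 1))]
                [:: (1, (0, 1, 0))] [:: (1, (2, 0, 0))]
  end.

Definition fbond : spin * spin -> spin * spin -> qpoly := flist
  [:: (1, 2, (4, (1, 0, 0))); (2, 1, (4, (-1, 0, 0)));
      (0, 0, (1, (1, 0, 0))); (0, 0, (1, (-1, 0, 0)));
      (1, 1, (-1, (1, 0, 0))); (1, 1, (-1, (-1, 0, 0)));
      (2, 2, (-1, (1, 0, 0))); (2, 2, (-1, (-1, 0, 0)));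
      (3, 3, (1, (1, 0, 0))); (3, 3, (1, (-1, 0, 0)))].

Definition fseam (sigma : pm) : spin * spin -> spin * spin -> qpoly :=
  match sigma with
  | plus => flist
    [:: (0, 1, (-2, (0, -1, -1))); (0, 2, (2, (3, -1, 0)));
        (0, 3, (-2, (4, -2, -1))); (1, 0, (-2, (2, 1, 1)));
        (1, 2, (2, (2, 0, 1))); (1, 3, (-2, (1, -1, 0)));
        (2, 0, (2, (-3, 1, 0))); (2, 1, (2, (-2, 0, -1)));
        (2, 3, (2, (2, -1, -1))); (3, 0, (-2, (0, 2, 1)));
        (3, 1, (-2, (-1, 1, 0))); (3, 2, (2, (0, 1, 1)))]
  | minus => flist
    [:: (0, 1, (2, (0, -1, 1))); (0, 2, (-2, (1, -1, 0)));
        (0, 3, (-2, (0, -2, 1))); (1, 0, (2, (-2, 1, -1)));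
        (1, 2, (2, (2, 0, -1))); (1, 3, (2, (3, -1, 0)));
        (2, 0, (-2, (-1, 1, 0))); (2, 1, (2, (-2, 0, 1)));
        (2, 3, (-2, (-2, -1, 1))); (3, 0, (-2, (-4, 2, -1)));
        (3, 1, (2, (-3, 1, 0))); (3, 2, (-2, (0, 1, -1)))]
  end.

(** * Identities between the tables, by computation *)

Lemma fgate_unitaryl sigma :
  feq spins (fmul spins (fadj (fgate sigma)) (fgate sigma)) (fscalar 2).
Proof. by case: sigma; vm_compute. Qed.

Lemma fgate_unitaryr sigma :
  feq spins (fmul spins (fgate sigma) (fadj (fgate sigma))) (fscalar 2).
Proof. by case: sigma; vm_compute. Qed.

Lemma fseam_hermitian sigma : feq spins2 (fadj (fseam sigma)) (fseam sigma).
Proof. by case: sigma; vm_compute. Qed.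

Lemma fseam_diag sigma : all (fun p => nilp (fseam sigma p p)) spins2.
Proof. by case: sigma; vm_compute. Qed.

(** The right side carries [fscalar 2] because each of the two gates on the left is scaled by
    [sqrt 2]; the factor 4 in [fbond] and [fseam] is common to both sides. *)
Lemma fseam_move sigma :
  let W := fB (fgate sigma) in
  let fm := fmul spins3 in
  feq spins3
    (fm (fm (fadj W) (fadd (fBC fbond) (fAB (fseam sigma)))) W)
    (fmul spins3 (fadd (fAB fbond) (fBC (fseam sigma))) (fscalar 2)).
Proof. by case: sigma; vm_compute. Qed.

(** * Adjoints of sums, products and block operators *)

Section Adjoints.
Variables (C : numClosedFieldType) (V : innerType C).
Implicit Types T U : V -> V.

Lemma inner_suml (J : Type) (s : seq J) (F : J -> V) v :
  inner (\sum_(t <- s) F t) v = \sum_(t <- s) inner (F t) v.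
Proof. exact: linear_sumlz. Qed.

Lemma inner_sumr (J : Type) (s : seq J) (F : J -> V) u :
  inner u (\sum_(t <- s) F t) = \sum_(t <- s) inner u (F t).
Proof. exact: linear_sumr. Qed.

(* If [U] had no adjoint, then [adj U] would be the junk value 0, and
   [adj U \o U = idfun] would force V = 0. *)
Lemma unitary_is_adjoint U : unitary_op U -> is_adjoint U (adj U).
Proof.
move=> [K _]; have [[T' TT']|noadj] := pselect (exists T', is_adjoint U T').
  by rewrite (adj_eq TT').
have adj0 : adj U = 0 by apply: xgetPN => T' TT'; apply: noadj; exists T'.
have V0 (v : V) : v = 0.
  by have := congr1 (@^~ v) K; rewrite /= adj0 => <-.
by move=> u v; rewrite (V0 v) (V0 (adj U 0)) /inner !linear0r.
Qed.

Lemma unitary_cancel U :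
  unitary_op U -> cancel U (op_inv U) /\ cancel (op_inv U) U.
Proof.
move=> [K1 K2].
have K : cancel U (adj U) by move=> v; apply: (congr1 (@^~ v) K1).
have K' : cancel (adj U) U by move=> v; apply: (congr1 (@^~ v) K2).
by rewrite (op_invE K K').
Qed.

Lemma unitary_adj U : unitary_op U -> adj U = op_inv U.
Proof.
move=> [K1 K2]; symmetry; apply: op_invE => v.
  exact: (congr1 (@^~ v) K1).
exact: (congr1 (@^~ v) K2).
Qed.

Lemma is_adjoint_scale (a : C) T T' :
  is_adjoint T T' -> is_adjoint (a *: T) (a^* *: T').
Proof.
move=> TT' u v.
rewrite -[LHS]/(inner (a *: T u) v) -[RHS]/(inner u (a^* *: T' v)).
by rewrite /inner linearZl_LR linearZr_LR /= conjCK -/(inner _ _) TT'.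
Qed.

Lemma is_adjoint_comp T T' U U' :
  is_adjoint T T' -> is_adjoint U U' -> is_adjoint (T \o U) (U' \o T').
Proof. by move=> TT' UU' u v; rewrite /= TT' UU'. Qed.

Lemma is_adjoint_sum (J : Type) (s : seq J) (F F' : J -> V -> V) :
  (forall t, is_adjoint (F t) (F' t)) ->
  is_adjoint (fun v => \sum_(t <- s) F t v) (fun v => \sum_(t <- s) F' t v).
Proof.
move=> FF' u v; rewrite inner_suml inner_sumr.
by apply: eq_bigr => t _; apply: FF'.
Qed.

(** Taking adjoints transposes the array of blocks, which on inner products amounts to exchanging
    the two sums. *)
Lemma is_adjoint_block (I : finType) (L L' : I -> I -> V -> V) :
  (forall i j, is_adjoint (L i j) (L' j i)) ->
  is_adjoint (op_block L) (op_block L').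
Proof.
move=> LL' f g; rewrite -[LHS]/(ffun_inner _ _) -[RHS]/(ffun_inner _ _).
rewrite /ffun_inner.
under eq_bigr => i _ do rewrite ffunE inner_suml.
under [RHS]eq_bigr => i _ do rewrite ffunE inner_sumr.
rewrite exchange_big; apply: eq_bigr => j _; apply: eq_bigr => i _.
exact: LL'.
Qed.
End Adjoints.

(** * Linearity and integer powers of operators *)

Section LinearFunctions.
Variables (C : numClosedFieldType) (U V : lmodType C) (T : U -> V).
Hypothesis hT : linear T.

Lemma linear_fun0 : T 0 = 0.
Proof. by have := hT (-1) 0 0; rewrite scaleN1r oppr0 addr0 scaleN1r addNr. Qed.

Lemma linear_funZ a v : T (a *: v) = a *: T v.
Proof. by rewrite -[a *: v]addr0 hT linear_fun0 addr0. Qed.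

Lemma linear_fun_sum (J : Type) (s : seq J) (F : J -> U) :
  T (\sum_(t <- s) F t) = \sum_(t <- s) T (F t).
Proof.
have TD : {morph T : u v / u + v}.
  by move=> u v; rewrite -[u]scale1r hT !scale1r.
exact: (big_morph T TD linear_fun0).
Qed.
End LinearFunctions.

(** Two-way induction derives the laws of integer powers from [T^(m+1) = T T^m] without a split by
    sign: the downward step cancels one factor [T]. *)
Lemma int_step_ind (P : int -> Prop) :
  P 0 -> (forall m, P m -> P (m + 1)) -> (forall m, P (m + 1) -> P m) ->
  forall m, P m.
Proof.
move=> P0 Pup Pdown; elim=> [//|n IHn|n IHn].
  by rewrite -addn1 PoszD; apply: Pup.
by apply: Pdown; rewrite -addn1 PoszD opprD addrNK.
Qed.

Section Powers.
Variables (C : numClosedFieldType) (V : lmodType C) (T : {linear V -> V}).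
Hypothesis (TK : cancel T (op_inv T)) (TVK : cancel (op_inv T) T).

Lemma op_expS m v : op_exp T (m + 1) v = T (op_exp T m v).
Proof.
case: m => [n|[|n]]; first by rewrite -PoszD addn1.
  by rewrite /= TVK.
have -> : Negz n.+1 + 1 = Negz n.
  by rewrite !NegzE -[n.+2]addn1 PoszD opprD addrNK.
by rewrite [in RHS]/op_exp iterS TVK.
Qed.

Lemma op_expD m n v : op_exp T (m + n) v = op_exp T m (op_exp T n v).
Proof.
elim/int_step_ind: m => [|m IHm|m IHm]; first by rewrite add0r.
  by rewrite addrAC !op_expS IHm.
by apply: (can_inj TK); rewrite -!op_expS -IHm addrAC.
Qed.

Lemma op_exp_linear m : linear (op_exp T m).
Proof.
elim/int_step_ind: m => [//|m IHm|m IHm] a u v.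
  by rewrite !op_expS IHm linearP.
by apply: (can_inj TK); rewrite linearP -!op_expS IHm.
Qed.

(** Each factor [T] that [A] passes contributes one [c]. The downward step cancels both [T] and [c],
    hence the hypothesis [c != 0]. *)
Lemma op_exp_qcomm (c : C) (A : V -> V) (hA : linear A) m v :
    c != 0 -> (forall u, A (T u) = c *: T (A u)) ->
  A (op_exp T m v) = c ^ m *: op_exp T m (A v).
Proof.
move=> c0 AT; elim/int_step_ind: m => [|m IHm|m IHm].
- by rewrite expr0z scale1r.
- by rewrite !op_expS AT IHm linearZ scalerA expfzDr // expr1z mulrC.
- apply: (can_inj TK); apply: (scalerI c0); rewrite -AT -op_expS IHm op_expS.
  by rewrite linearZ scalerA expfzDr // expr1z mulrC.
Qed.
End Powers.

Lemma is_adjoint_exp (C : numClosedFieldType) (V : innerType C)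
    (U : {linear V -> V}) (hU : unitary_op U) m :
  is_adjoint (op_exp U m) (op_exp U (- m)).
Proof.
have [K K'] := unitary_cancel hU.
have UU' := unitary_is_adjoint hU; rewrite unitary_adj // in UU'.
elim/int_step_ind: m => [//|m IHm|m IHm] u v.
  by rewrite op_expS // UU' IHm opprD op_expD.
(* Writing [v] as [U^-1 (U v)] lets the inverse move to the left as one more factor [U], which
   reaches the exponent [m + 1] of the hypothesis. *)
rewrite -{1}[v]K -UU' -op_expS // IHm opprD op_expD //.
by rewrite -[op_exp U (-1) _]/(op_inv U (U v)) K.
Qed.

(** * Evaluation of formal terms and matrices as operators *)

Section Evaluation.
Variables (C : numClosedFieldType) (V : innerType C) (q : C).
Variables (X Z : {linear V -> V}).
Hypotheses (hq : `|q| = 1) (hX : unitary_op X) (hZ : unitary_op Z).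
Hypothesis (hZX : Z \o X = q ^+ 2 *: (X \o Z)).

Let q0 : q != 0. Proof. by rewrite -normr_eq0 hq oner_eq0. Qed.

Lemma exp_weyl m n v :
  op_exp Z n (op_exp X m v) = q ^ (2 * (n * m)) *: op_exp X m (op_exp Z n v).
Proof.
have [XK XVK] := unitary_cancel hX; have [ZK ZVK] := unitary_cancel hZ.
have ZXm u : Z (op_exp X m u) = q ^ (2 * m) *: op_exp X m (Z u).
  rewrite (@op_exp_qcomm _ _ X _ _ (q ^ 2)) ?expfz_neq0 ?exprz_exp //.
  - exact: linearP.
  - by move=> w; apply: (congr1 (@^~ w) hZX).
(* The relation is turned around so that [op_exp_qcomm] applies a second time, now with [X^m]
   passing the powers of [Z]. *)
have XmZ u : op_exp X m (Z u) = q ^ (- (2 * m)) *: Z (op_exp X m u).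
  by rewrite ZXm scalerA -expfzDr // addNr expr0z scale1r.
rewrite (@op_exp_qcomm _ _ Z _ _ (q ^ (- (2 * m)))) ?expfz_neq0 //; last first.
  exact: op_exp_linear.
rewrite exprz_exp scalerA -expfzDr //.
by rewrite mulNr [n * m]mulrC mulrA subrr expr0z scale1r.
Qed.

Definition term_eval (t : term) : V -> V :=
  (t.1%:~R * q ^ t.2.1.1) *: Y X Z t.2.1.2 t.2.2.

Definition qeval (p : qpoly) : V -> V := fun v => \sum_(t <- p) term_eval t v.

Lemma term_evalE c k m n v : term_eval (c, (k, m, n)) v =
  (c%:~R * q ^ k) *: op_exp X m (op_exp Z n v).
Proof. by []. Qed.

Lemma term_eval_linear t : linear (term_eval t).
Proof.
have [XK XVK] := unitary_cancel hX; have [ZK ZVK] := unitary_cancel hZ.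
case: t => c [[k m] n] a u v; rewrite !term_evalE.
by rewrite !op_exp_linear // scalerDr !scalerA mulrC.
Qed.

Lemma qeval_linear p : linear (qeval p).
Proof.
move=> a u v; rewrite /qeval scaler_sumr -big_split.
by apply: eq_bigr => t _; apply: term_eval_linear.
Qed.

Lemma term_eval_mul t u v :
  term_eval (term_mul t u) v = term_eval t (term_eval u v).
Proof.
have [XK XVK] := unitary_cancel hX; have [ZK ZVK] := unitary_cancel hZ.
case: t u => c [[k m] n] [d [[l m'] n']]; rewrite !term_evalE.
do !rewrite (linear_funZ (op_exp_linear _ _ _)) //.
rewrite exp_weyl (linear_funZ (op_exp_linear _ _ _)) // -!op_expD // !scalerA.
congr (_ *: _); rewrite !expfzDr // intrM; ring.
Qed.

Lemma qeval_nil : qeval [::] = 0.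
Proof. by apply/funext => v; rewrite /qeval big_nil. Qed.

Lemma qeval_cons t p v : qeval (t :: p) v = term_eval t v + qeval p v.
Proof. by rewrite /qeval big_cons. Qed.

Lemma qeval_cat p r v : qeval (p ++ r) v = qeval p v + qeval r v.
Proof. by rewrite /qeval big_cat. Qed.

Lemma qeval_flatten (J : Type) (s : seq J) (F : J -> qpoly) v :
  qeval (flatten [seq F k | k <- s]) v = \sum_(k <- s) qeval (F k) v.
Proof.
elim: s => [|k s IHs] /=; first by rewrite qeval_nil big_nil.
by rewrite qeval_cat IHs big_cons.
Qed.

Lemma qeval_mul p r v : qeval (qmul p r) v = qeval p (qeval r v).
Proof.
rewrite /qeval big_allpairs_dep; apply: eq_bigr => t _.
rewrite (linear_fun_sum (term_eval_linear t)).
by apply: eq_bigr => u _; apply: term_eval_mul.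
Qed.

Lemma term_eval_adjoint t : is_adjoint (term_eval t) (term_eval (term_adj t)).
Proof.
case: t => c [[k m] n].
have -> : term_eval (term_adj (c, (k, m, n))) =
    (c%:~R * q ^ k)^* *: (op_exp Z (- n) \o op_exp X (- m)).
  apply/funext => v; rewrite term_evalE -[RHS]/(_ *: op_exp Z _ (op_exp X _ v)).
  rewrite exp_weyl scalerA rmorphM /= rmorph_int fmorphXz /=.
  have -> : q^* = q^-1 by rewrite invC_norm hq expr1n invr1 mul1r.
  rewrite exprz_inv -mulrA -expfzDr // mulrNN [n * m]mulrC addrC.
  by [].
apply: is_adjoint_scale; apply: is_adjoint_comp; exact: is_adjoint_exp.
Qed.

Lemma qeval_adjoint p : is_adjoint (qeval p) (qeval (map term_adj p)).
Proof.
rewrite /qeval; under [X in is_adjoint _ X]eq_fun => v do rewrite big_map.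
exact: (is_adjoint_sum _ term_eval_adjoint).
Qed.

Lemma term_eval_opp t v : term_eval (term_opp t) v = - term_eval t v.
Proof. by case: t => c [[k m] n]; rewrite !term_evalE intrN mulNr scaleNr. Qed.

Lemma qeval_opp p v : qeval (map term_opp p) v = - qeval p v.
Proof.
rewrite /qeval big_map -sumrN; apply: eq_bigr => t _; exact: term_eval_opp.
Qed.

Lemma qeval_insert t p v : qeval (qinsert t p) v = term_eval t v + qeval p v.
Proof.
elim: p => [|u p IHp] //=; first by rewrite qeval_cons.
case: eqP => [tu|_]; last by rewrite !qeval_cons IHp addrCA.
rewrite !qeval_cons addrA; congr (_ + _).
case: t u tu {IHp} => c [[k m] n] [d _] /= <-.
by rewrite !term_evalE intrD mulrDl scalerDl.
Qed.

Lemma qeval_norm p v : qeval (foldr qinsert [::] p) v = qeval p v.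
Proof. by elim: p => //= t p IHp; rewrite qeval_insert IHp qeval_cons. Qed.

Lemma qzero_sound p v : qzero p -> qeval p v = 0.
Proof.
rewrite -qeval_norm /qzero; elim: (foldr _ _ _) => [|[c [[k m] n]] r IHr] /=.
  by rewrite qeval_nil.
case/andP=> /eqP -> /IHr IH.
by rewrite qeval_cons IH term_evalE mul0r scale0r addr0.
Qed.

Lemma qeq_sound p r : qeq p r -> qeval p = qeval r.
Proof.
move=> /qzero_sound pr; apply/funext => v; apply/eqP.
by rewrite -subr_eq0 -qeval_opp -qeval_cat pr.
Qed.

Section Matrices.
Variables (I : finType) (e : seq I).
Hypothesis he : perm_eq (index_enum I) e.
Implicit Types (F G : I -> I -> qpoly).

Definition feval F : {ffun I -> V} -> {ffun I -> V} :=
  op_block (fun i j => qeval (F i j)).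

Lemma feval_linear F : linear (feval F).
Proof.
move=> a f g; apply/ffunP => i; rewrite !ffunE scaler_sumr -big_split.
by apply: eq_bigr => j _; rewrite !ffunE qeval_linear.
Qed.

Lemma feval_add F G : feval (fadd F G) = feval F + feval G.
Proof.
apply/funext => f; apply/ffunP => i; rewrite !ffunE -big_split.
by apply: eq_bigr => j _; rewrite qeval_cat.
Qed.

Lemma feval_mul F G : feval (fmul e F G) = feval F \o feval G.
Proof.
apply/funext => f; apply/ffunP => i; rewrite !ffunE.
under eq_bigr => j _ do rewrite qeval_flatten.
rewrite exchange_big -(perm_big _ he) /=; apply: eq_bigr => k _.
rewrite ffunE (linear_fun_sum (qeval_linear _)).
by apply: eq_bigr => j _; rewrite qeval_mul.
Qed.

Lemma feval_adjoint F : is_adjoint (feval F) (feval (fadj F)).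
Proof. apply: is_adjoint_block => i j; exact: qeval_adjoint. Qed.

Lemma feval_scalar c : feval (fscalar c) = (fun f => c%:~R *: f).
Proof.
apply/funext => f; apply/ffunP => i; rewrite !ffunE (bigD1 i) //=.
rewrite /fscalar eqxx qeval_cons qeval_nil term_evalE expr0z mulr1.
rewrite big1 ?addr0 // => j; rewrite eq_sym => /negPf ->.
by rewrite qeval_nil.
Qed.

(** The bridge from a computed table check to an operator identity: [he] guarantees that the
    explicit list [e] reaches every index. *)
Lemma feq_sound F G : feq e F G -> feval F = feval G.
Proof.
move=> /allP FG; apply/funext => f; apply/ffunP => i; rewrite !ffunE.
apply: eq_bigr => j _; congr (_ _); apply: qeq_sound.
have eP k : k \in e by rewrite -(perm_mem he) mem_index_enum.
exact: (allP (FG i (eP i)) j (eP j)).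
Qed.
End Matrices.

(** * Placement of one- and two-site operators on three sites *)

Lemma on_B_feval F : on_B (feval F) = feval (fB F).
Proof.
apply/funext => f; apply/ffunP => -[[a b] c]; rewrite !ffunE.
(* Columns that change a spectator spin have the empty entry [[::]] and drop out; the remaining ones
   are indexed by the middle spin alone. *)
rewrite [RHS](bigID (fun p => (a == p.1.1) && (c == p.2))) /=.
rewrite [X in _ + X]big1 ?addr0; last first.
  by move=> p /negPf acp; rewrite /fB /= acp qeval_nil.
rewrite [RHS](reindex_onto (fun b' => (a, b', c)) (fun p => p.1.2)) /=;
  last first.
  by move=> [[a' b'] c'] /= /andP[/eqP -> /eqP ->].
apply: eq_big => [b'|b' _]; first by rewrite /= ?eqxx.
by rewrite ffunE /fB /= !eqxx.
Qed.

Lemma on_AB_feval F : on_AB (feval F) = feval (fAB F).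
Proof.
apply/funext => f; apply/ffunP => -[[a b] c]; rewrite !ffunE.
rewrite [RHS](bigID (fun p => c == p.2)) /=.
rewrite [X in _ + X]big1 ?addr0; last first.
  by move=> p /negPf cp; rewrite /fAB /= cp qeval_nil.
rewrite [RHS](reindex_onto (fun ab => (ab, c)) (fun p => p.1)) /=; last first.
  by move=> [ab c'] /eqP ->.
apply: eq_big => [ab|[a' b'] _]; first by rewrite /= ?eqxx.
by rewrite ffunE /fAB /= !eqxx.
Qed.

Lemma on_BC_feval F : on_BC (feval F) = feval (fBC F).
Proof.
apply/funext => f; apply/ffunP => -[[a b] c]; rewrite !ffunE.
rewrite [RHS](bigID (fun p => a == p.1.1)) /=.
rewrite [X in _ + X]big1 ?addr0; last first.
  by move=> p /negPf ap; rewrite /fBC /= ap qeval_nil.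
rewrite [RHS](reindex_onto
  (fun bc => (a, bc.1, bc.2)) (fun p => (p.1.2, p.2))) /=.
  apply: eq_big => [[b' c']|[b' c'] _]; first by rewrite /= ?eqxx.
  by rewrite ffunE /fBC /= !eqxx.
by move=> [[a' b'] c'] /eqP ->.
Qed.

(** * The operators of the theorem as rescaled evaluations of the tables *)

Lemma ket_eq (p : spin * spin) (r : 'I_4) :
  (p == ket r) = (r == 2 * p.1 + p.2 :> nat)%N.
Proof.
case: p => a b; rewrite xpair_eqE -!val_eqE /= !inordK ?ltn_mod ?ltn_divLR //.
rewrite {3}(divn_eq r 2) mulnC; case: r a b => r hr [a ha] [b hb] /=.
case: (r %% 2)%N (ltn_mod r 2) => [|[|//]] _;
  case: a ha => [|[|//]] _; case: b hb => [|[|//]] _; lia.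
Qed.

Lemma feval_flist l : feval (flist l) =
  \sum_(e <- l) (e.2.1%:~R * q ^ e.2.2.1.1) *:
    E_unit e.1.1 e.1.2 (Y X Z e.2.2.1.2 e.2.2.2).
Proof.
elim: l => [|[[r c] t] l IHl].
  rewrite big_nil; apply/funext => f; apply/ffunP => p; rewrite !ffunE.
  by apply: big1 => p' _; rewrite qeval_nil.
rewrite big_cons -IHl; apply/funext => f; apply/ffunP => p.
rewrite !ffunE scaler_sumr -big_split; apply: eq_bigr => p' _ /=.
rewrite !ket_eq /flist /=; case: ifP => _; first by rewrite qeval_cons.
by rewrite scaler0 add0r.
Qed.

Lemma gate_WE sigma :
  gate_W q X Z sigma = (sqrtC 2)^-1 *: feval (fgate sigma).
Proof.
congr (_ *: _); apply/funext => f; apply/ffunP => i; rewrite !ffunE.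
apply: eq_bigr => j _.
case: sigma; rewrite /gate_L /fgate /mx2; case: (i == 0); case: (j == 0);
  rewrite qeval_cons qeval_nil addr0 term_evalE /= ?mul1r ?scale1r //.
all: by congr (_ *: _); rewrite ?intrN ?mulN1r.
Qed.

(** [Y X Z 0 0] is the identity, written this way to match the summands produced by
    [feval_flist]. *)
Lemma spin_pmE :
  @spin_op2 C V (sigma_p C) (sigma_m C) = E_unit 1 2 (Y X Z 0 0).
Proof.
apply/funext => f; apply/ffunP => p; rewrite !ffunE; apply: eq_bigr => p' _.
rewrite !ket_eq !mxE; case: p p' => [a b] [a' b'] /=.
case: a b a' b' => [[|[|//]] ?] [[|[|//]] ?] [[|[|//]] ?] [[|[|//]] ?] /=;
  by rewrite ?mulr0 ?mul0r ?mulr1 ?scale0r ?scale1r.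
Qed.

Lemma spin_mpE :
  @spin_op2 C V (sigma_m C) (sigma_p C) = E_unit 2 1 (Y X Z 0 0).
Proof.
apply/funext => f; apply/ffunP => p; rewrite !ffunE; apply: eq_bigr => p' _.
rewrite !ket_eq !mxE; case: p p' => [a b] [a' b'] /=.
case: a b a' b' => [[|[|//]] ?] [[|[|//]] ?] [[|[|//]] ?] [[|[|//]] ?] /=;
  by rewrite ?mulr0 ?mul0r ?mulr1 ?scale0r ?scale1r.
Qed.

Lemma spin_zzE : @spin_op2 C V (sigma_z C) (sigma_z C) =
  E_unit 0 0 (Y X Z 0 0) - E_unit 1 1 (Y X Z 0 0) - E_unit 2 2 (Y X Z 0 0)
  + E_unit 3 3 (Y X Z 0 0).
Proof.
apply/funext => f; apply/ffunP => p; rewrite !ffunE -!sumrN -!big_split.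
apply: eq_bigr => p' _ /=.
rewrite !ket_eq !mxE; case: p p' => [a b] [a' b'] /=.
case: a b a' b' => [[|[|//]] ?] [[|[|//]] ?] [[|[|//]] ?] [[|[|//]] ?] /=;
  by rewrite /mx2 /= ?mulr0 ?mul0r ?mulr1 ?mulrN1 ?opprK ?scale0r ?scaleN1r
     ?scale1r ?oppr0 ?addr0 ?add0r.
Qed.

Lemma bondE : bond V q = 4^-1 *: feval fbond.
Proof.
have h4 k : 4^-1 * (4%:~R * q ^ k) = q ^ k by field.
have h1 k : 4^-1 * (1%:~R * q ^ k) = q ^ k / 4 by field.
have hN1 k : 4^-1 * ((-1)%:~R * q ^ k) = - (q ^ k / 4) by field.
rewrite /bond spin_pmE spin_mpE spin_zzE feval_flist !big_cons big_nil addr0 /=.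
(* The six matrix units become variables, so that only a comparison of scalar coefficients is
   left. *)
do 6!(move: (E_unit _ _ _) => ?).
rewrite !scalerDr !scalerN mulrDl !scalerDl !scalerA !h4 !h1 !hN1.
by rewrite !scaleNr !opprD !addrA.
Qed.

Lemma seamE sigma : seam q X Z sigma = 4^-1 *: feval (fseam sigma).
Proof.
(* One half is the prefactor in [seam]; the other cancels the entries [2] and [-2] of the table. *)
have -> : 4^-1 = 2^-1 * 2^-1 :> C by field.
have h2 k : 2^-1 * (2%:~R * q ^ k) = q ^ k by field.
have hN2 k : 2^-1 * ((-2)%:~R * q ^ k) = - q ^ k by field.
case: sigma; rewrite /seam /fseam feval_flist !big_cons big_nil addr0 /=;
  rewrite -[RHS]scalerA; congr (_ *: _);
  do 12!(move: (E_unit _ _ _) => ?);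
  by rewrite !scalerDr !scalerA !h2 !hN2 !scaleNr !expr0z !scale1r !addrA.
Qed.

Lemma spins_enum : perm_eq (index_enum spin) spins.
Proof.
apply: uniq_perm; rewrite ?index_enum_uniq // => i; rewrite mem_index_enum.
by case: i => [[|[|//]] ?].
Qed.

Lemma spins2_enum : perm_eq (index_enum (spin * spin)%type) spins2.
Proof.
apply: uniq_perm; rewrite ?index_enum_uniq // => -[i j]; rewrite mem_index_enum.
by case: i j => [[|[|//]] ?] [[|[|//]] ?].
Qed.

Lemma spins3_enum : perm_eq (index_enum (spin * spin * spin)%type) spins3.
Proof.
apply: uniq_perm; rewrite ?index_enum_uniq // => -[[i j] k].
rewrite mem_index_enum.
by case: i j k => [[|[|//]] ?] [[|[|//]] ?] [[|[|//]] ?].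
Qed.

(** * Transfer of the table identities to the gates and seams *)

Lemma adj_scale_feval (I : finType) (d : C) (F : I -> I -> qpoly) :
  d^* = d -> adj (d *: feval F) = d *: feval (fadj F).
Proof.
move=> dr; apply: adj_eq; rewrite -{2}dr.
apply: is_adjoint_scale; exact: feval_adjoint.
Qed.

Lemma scale_feval_comp (I : finType) (d d' : C) (F G : I -> I -> qpoly) :
  (d *: feval F) \o (d' *: feval G) = (d * d') *: (feval F \o feval G).
Proof.
apply/funext => f; rewrite -[LHS]/(d *: feval F (d' *: feval G f)).
by rewrite (linear_funZ (feval_linear _)) scalerA.
Qed.

Let s2 := (sqrtC 2 : C)^-1.

Let s2_conj : s2^* = s2.
Proof. by apply/CrealP; rewrite realV ger0_real // sqrtC_ge0 ler0n. Qed.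

Let s2_sqr : s2 * s2 = 2^-1.
Proof. by rewrite -invfM -expr2 sqrtCK. Qed.

Let quarter_conj : (4^-1 : C)^* = 4^-1.
Proof. by rewrite fmorphV rmorph_nat. Qed.

Lemma gate_unitary sigma : let W := gate_W q X Z sigma in
  adj W \o W = idfun /\ W \o adj W = idfun.
Proof.
rewrite gate_WE /= adj_scale_feval // !scale_feval_comp s2_sqr.
rewrite -!(feval_mul spins_enum) (feq_sound spins_enum (fgate_unitaryl sigma)).
rewrite (feq_sound spins_enum (fgate_unitaryr sigma)) feval_scalar.
suff -> : 2^-1 *: (fun f : {ffun spin -> V} => 2%:~R *: f) = idfun by [].
apply/funext => f; rewrite -[LHS]/(2^-1 *: (2 *: f)).
by rewrite scalerA mulVf ?pnatr_eq0 // scale1r.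
Qed.

Lemma seam_hermitian sigma : hermitian_op (seam q X Z sigma).
Proof.
rewrite /hermitian_op seamE adj_scale_feval //.
by rewrite (feq_sound spins2_enum (fseam_hermitian sigma)).
Qed.

Lemma on_B_scale (d : C) T :
  on_B (d *: T) = d *: on_B T :> (_ -> {ffun _ -> V}).
Proof. by apply/funext => f; apply/ffunP => -[[a b] c]; rewrite !ffunE. Qed.

Lemma on_AB_scale (d : C) T :
  on_AB (d *: T) = d *: on_AB T :> (_ -> {ffun _ -> V}).
Proof. by apply/funext => f; apply/ffunP => -[[a b] c]; rewrite !ffunE. Qed.

Lemma on_BC_scale (d : C) T :
  on_BC (d *: T) = d *: on_BC T :> (_ -> {ffun _ -> V}).
Proof. by apply/funext => f; apply/ffunP => -[[a b] c]; rewrite !ffunE. Qed.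

Lemma seam_move sigma :
  let W := gate_W q X Z sigma in
  let S := seam q X Z sigma in
  let h := bond V q in
  adj (on_B W) \o (on_BC h + on_AB S) \o on_B W = on_AB h + on_BC S.
Proof.
have hl : on_BC (bond V q) + on_AB (seam q X Z sigma) =
    4^-1 *: feval (fadd (fBC fbond) (fAB (fseam sigma))).
  by rewrite bondE seamE on_BC_scale on_AB_scale on_BC_feval on_AB_feval
     feval_add scalerDr.
have hr : on_AB (bond V q) + on_BC (seam q X Z sigma) =
    4^-1 *: feval (fadd (fAB fbond) (fBC (fseam sigma))).
  by rewrite bondE seamE on_AB_scale on_BC_scale on_BC_feval on_AB_feval
     feval_add scalerDr.
rewrite /= hl hr gate_WE on_B_scale on_B_feval adj_scale_feval //.
rewrite scale_feval_comp.
rewrite -(feval_mul spins3_enum) scale_feval_comp -(feval_mul spins3_enum).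
rewrite (feq_sound spins3_enum (fseam_move sigma)) (feval_mul spins3_enum).
apply/funext => f; rewrite feval_scalar.
rewrite -[LHS]/(_ *: feval _ (2 *: f)) (linear_funZ (feval_linear _)) scalerA.
(* The two gate normalizations [s2] cancel the 2 coming from [fscalar 2], which leaves the common
   factor [1/4]. *)
congr (_ *: _); transitivity (s2 * s2 * 4^-1 * 2);
  last by rewrite s2_sqr; field.
by rewrite -/s2; ring.
Qed.

Lemma seam_linear sigma : linear (seam q X Z sigma).
Proof.
rewrite seamE => a f g.
rewrite -[LHS]/(_ *: feval _ _) feval_linear scalerDr !scalerA.
by rewrite mulrC -scalerA.
Qed.

Lemma seam_coefficient sigma p : coefficient (seam q X Z sigma) p p = 0.
Proof.
apply/funext => v; rewrite seamE /coefficient.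
rewrite -[LHS]/((4^-1 *: feval _ _) p) !ffunE big1 ?scaler0 // => p' _.
(* [ket_tensor p v] vanishes away from [p], so only the entry at [(p, p)] survives, and its table
   entry is empty. *)
rewrite ffunE; case: eqP => [->|_]; last exact: linear_fun0 (qeval_linear _).
have := allP (fseam_diag sigma) p; rewrite -(perm_mem spins2_enum).
by rewrite mem_index_enum => /(_ isT) /nilP ->; rewrite qeval_nil.
Qed.
End Evaluation.

(** * Independence of the trace from the basis *)

Section TraceBasis.
Variables (C : numClosedFieldType) (V : lmodType C).

Lemma is_basis_coord n (b : 'I_n -> V) : is_basis b ->
  exists2 co : V -> 'rV[C]_n, (forall v, v = \sum_i co v 0 i *: b i)
  & forall v (c : 'rV[C]_n), v = \sum_i c 0 i *: b i -> co v = c.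
Proof.
move=> hb; have [co hco] := choice hb.
by exists co => [v|v c vc]; have [? U] := hco v; [|apply: U].
Qed.

(** A single basis decides [has_trace]: in another basis the matrix is [P' A P] with [P P' = 1], and
    the trace is cyclic. Cyclicity holds for rectangular factors, so [n = n'] need not be
    established first. *)
Lemma has_trace_basis n (b : 'I_n -> V) (T : V -> V) (A : 'M[C]_n) :
  linear T -> is_basis b -> represents b T A -> has_trace T (\tr A).
Proof.
move=> hT hb bTA; split; first by exists n, b.
have [co coE coU] := is_basis_coord hb.
move=> n' b' hb'; have [co' coE' coU'] := is_basis_coord hb'.
pose P := \matrix_(i < n, j < n') co (b' j) 0 i.
pose P' := \matrix_(i < n', j < n) co' (b j) 0 i.
have bP' j : b j = \sum_k P' k j *: b' k.
  by rewrite {1}[b j]coE'; apply: eq_bigr => k _; rewrite mxE.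
have b'P j : b' j = \sum_k P k j *: b k.
  by rewrite {1}[b' j]coE; apply: eq_bigr => k _; rewrite mxE.
have mulE m1 m2 m3 (M : 'M[C]_(m1, m2)) (N : 'M[C]_(m2, m3))
    (x : 'I_m1 -> V) j :
    \sum_k (M *m N) k j *: x k = \sum_l N l j *: \sum_k M k l *: x k.
  under [RHS]eq_bigr => l _ do rewrite scaler_sumr.
  rewrite exchange_big; apply: eq_bigr => k _; rewrite mxE scaler_suml.
  by apply: eq_bigr => l _; rewrite scalerA mulrC.
exists (P' *m (A *m P)) => [j|].
  rewrite {1}b'P (linear_fun_sum hT) mulE mulE; apply: eq_bigr => k _.
  rewrite (linear_funZ hT) bTA; congr (_ *: _).
  by apply: eq_bigr => l _; rewrite -bP'.
rewrite mxtrace_mulC -mulmxA; suff -> : P *m P' = 1%:M by rewrite mulmx1.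
apply/matrixP => i j; rewrite -[LHS]/((P *m P') i j).
(* [P P' = 1] follows by reading the coordinates of [b j] in [b] twice: through the basis [b'], and
   directly as a unit vector. *)
have e1 : co (b j) = \row_k (P *m P') k j.
  apply: coU; under eq_bigr => k _ do rewrite mxE.
  by rewrite mulE {1}bP'; apply: eq_bigr => k _; rewrite -b'P.
have e2 : co (b j) = \row_k (1%:M : 'M[C]_n) k j.
  apply: coU; rewrite (bigD1 j) //= !mxE eqxx scale1r big1 ?addr0 // => k kj.
  by rewrite !mxE (negPf kj) scale0r.
by have := congr1 (fun r : 'rV[C]_n => r 0 i) (etrans (esym e1) e2);
  rewrite !mxE.
Qed.
End TraceBasis.

(** * Product bases and the trace of an operator with zero diagonal blocks *)

Section TensorTrace.
Variables (C : numClosedFieldType) (V : lmodType C) (I : finType).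

(** Pairs are numbered through [enum_val] because [is_basis] expects a family indexed by an ordinal
    type. *)
Definition tensor_basis n (b : 'I_n -> V)
    (k : 'I_#|{: I * 'I_n}|) : {ffun I -> V} :=
  ket_tensor (enum_val k).1 (b (enum_val k).2).

Lemma tensor_basis_sum n (b : 'I_n -> V) (c : I * 'I_n -> C) i :
  (\sum_k c (enum_val k) *: tensor_basis b k) i = \sum_l c (i, l) *: b l.
Proof.
rewrite sum_ffunE (reindex _ (onW_bij _ (@enum_rank_bij _))) /=.
transitivity (\sum_j \sum_l (c (j, l) *: ket_tensor j (b l)) i).
  rewrite pair_bigA; apply: eq_bigr => -[j l] _.
  by rewrite /tensor_basis enum_rankK.
rewrite (bigD1 i) //= [X in _ + X]big1 ?addr0.
  by apply: eq_bigr => l _; rewrite !ffunE eqxx.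
move=> j ji; apply: big1 => l _.
by rewrite !ffunE eq_sym (negPf ji) scaler0.
Qed.

Lemma tensor_basisP n (b : 'I_n -> V) : is_basis b -> is_basis (tensor_basis b).
Proof.
move=> hb f; have [co coE coU] := is_basis_coord hb.
exists (\row_k co (f (enum_val k).1) 0 (enum_val k).2); split.
  apply/ffunP => i; under eq_bigr => k _ do rewrite mxE.
  by rewrite (tensor_basis_sum b (fun p => co (f p.1) 0 p.2)) [LHS]coE.
move=> c fc; apply/rowP => k; rewrite mxE.
(* Grouping the coordinates by spin configuration reduces uniqueness to that of [b] in each
   component of [f]. *)
pose c' i : 'rV[C]_n := \row_l c 0 (enum_rank (i, l)).
have -> : co (f (enum_val k).1) = c' (enum_val k).1.
  apply: coU; rewrite fc.
  have -> : \sum_k c 0 k *: tensor_basis b k =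
      \sum_k c 0 (enum_rank (enum_val k)) *: tensor_basis b k.
    by apply: eq_bigr => l _; rewrite enum_valK.
  rewrite (tensor_basis_sum b (fun p => c 0 (enum_rank p))).
  by apply: eq_bigr => l _; rewrite mxE.
by rewrite mxE -surjective_pairing enum_valK.
Qed.

(** In a product basis the diagonal entry at [(i, l)] is the [l]-th coordinate of
    [coefficient T i i (b l)], hence zero. *)
Lemma has_trace0 (T : {ffun I -> V} -> {ffun I -> V}) :
    linear T -> (forall i, coefficient T i i = 0) -> finite_dim V ->
  has_trace T 0.
Proof.
move=> hT T0 [n [b hb]]; have [co coE coU] := is_basis_coord hb.
pose c l (p : I * 'I_n) := co (T (tensor_basis b l) p.1) 0 p.2.
pose A : 'M[C]_#|{: I * 'I_n}| := \matrix_(k, l) c l (enum_val k).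
have -> : 0 = \tr A.
  rewrite /mxtrace big1 // => k _; rewrite mxE /c.
  rewrite -[T _ _]/(coefficient T _ _ _) T0.
  have -> : co 0 = 0.
    by apply: coU; rewrite big1 // => l _; rewrite mxE scale0r.
  by rewrite mxE.
apply: (has_trace_basis hT (tensor_basisP hb)) => l.
apply/ffunP => i; under eq_bigr => k _ do rewrite mxE.
by rewrite (tensor_basis_sum b (c l)) [LHS]coE.
Qed.
End TensorTrace.

Theorem theorem3p1 (R : realType) (H : hilbertType R) (q : R[i])
    (X Z : {linear H -> H}) (sigma : pm)
    (hq : `|q| = 1) (hX : unitary_op X) (hZ : unitary_op Z)
    (hZX : Z \o X = q ^+ 2 *: (X \o Z)) :
  let W := gate_W q X Z sigma in
  let S := seam q X Z sigma in
  let h := bond H q in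
  (adj W \o W = idfun /\ W \o adj W = idfun)
  /\
  (hermitian_op S /\
   adj (on_B W) \o (on_BC h + on_AB S) \o on_B W = on_AB h + on_BC S)
  /\
  ((forall r : 'I_4, coefficient S (ket r) (ket r) = 0) /\
   partial_trace S = 0 /\
   (finite_dim H -> has_trace S 0)).
Proof.
have S0 p : coefficient (seam q X Z sigma) p p = 0 by exact: seam_coefficient.
move=> W S h; split; first exact: gate_unitary.
split; first by split; [exact: seam_hermitian|exact: seam_move].
split; first by move=> r; apply: S0.
split; first by apply: big1 => p _; apply: S0.
by move=> fH; apply: has_trace0 => //; apply: seam_linear.
Qed.
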